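(* Let $k\ge 1$ and $n\ge 0$ be integers and let $P=U^kD^k$. The number $d_n(P)$ of Dyck paths of semilength $n$ avoiding the pattern $P$ is $$d_n(P)=\begin{cases}0 & \text{if } n\ge 2k-1,\\[4pt] \displaystyle\sum_{j\ge 1}b_{k-j,\,n-k+j}^2 & \text{otherwise.}\end{cases}$$
   Context: A Dyck path of semilength $n$ is a word of length $2n$ on the alphabet $\{U,D\}$ with $n$ letters $U$ and $n$ letters $D$ in which every prefix contains at least as many $U$'s as $D$'s. A Dyck path $Q$ contains the pattern $P$ (another Dyck path) if $P$ is a (not necessarily contiguous) subword, i.e. subsequence, of $Q$; otherwise $Q$ avoids $P$. A Dyck prefix is a word on $\{U,D\}$ all of whose prefixes contain at least as many $U$'s as $D$'s. The ballot number $b_{i,j}$ is the number of Dyck prefixes with exactly $i$ letters $U$ and $j$ letters $D$ when $0\le j\le i$, and $b_{i,j}=0$ for all other integers $i,j$. *)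

(* Defs.v *)
From mathcomp Require Import all_boot all_order all_algebra.

Set Implicit Arguments.
Unset Strict Implicit.
Unset Printing Implicit Defensive.

Definition letter := bool.
Definition U : letter := true.
Definition D : letter := false.

Definition dyck_prefix (w : seq letter) : bool :=
  [forall m : 'I_(size w).+1,
     count_mem D (take m w) <= count_mem U (take m w)].

Definition dyck_path (n : nat) (w : seq letter) : bool :=
  [&& count_mem U w == n, count_mem D w == n & dyck_prefix w].

(* Pattern containment: not necessarily contiguous. *)
Definition contains (P Q : seq letter) : bool := subseq P Q.

Definition num_avoiding (n : nat) (P : seq letter) : nat :=
  #|[set w : (2 * n).-tuple letter | dyck_path n w && ~~ contains P w]|.

(* The guard makes i and j nonnegative, so that `|i| and `|j| lose nothing. *)
Definition ballot (i j : int) : nat :=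
  if (0 <= j <= i)%R then
    #|[set w : (`|i| + `|j|).-tuple letter |
        [&& count_mem U w == `|i|, count_mem D w == `|j| & dyck_prefix w]]|
  else 0.

(* Main.v *)
Require Import Defs.
From mathcomp Require Import all_boot all_order all_algebra.
From mathcomp Require Import classical_sets fsbigop.
From mathcomp Require Import zify.

(** Cut a Dyck path of semilength n into halves a b of length n each. If a has
    i letters U, then b has i letters D, so the path contains U^k D^k when
    i >= k. Conversely, in an occurrence of U^k D^k either all the U's lie in a
    or all the D's lie in b, and both cases force i >= k. So the avoiding paths
    are those with i < k; for fixed i, both a and the reversal of b with letters
    exchanged are arbitrary Dyck prefixes of length n with i letters U. *)

Lemma count_UD (w : seq letter) : count_mem U w + count_mem D w = size w.
Proof. by elim: w => //= -[] w /= <-; lia. Qed.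

Lemma dyck_prefixP (w : seq letter) :
  reflect (forall m, count_mem D (take m w) <= count_mem U (take m w))
          (dyck_prefix w).
Proof.
apply: (iffP forallP) => [H m|H m]; last exact: H.
have [lt_mw|le_wm] := ltnP m (size w).+1; first exact: (H (Ordinal lt_mw)).
by have := H ord_max; rewrite /= take_size take_oversize // ltnW.
Qed.

Lemma dyck_prefix_count {w : seq letter} :
  dyck_prefix w -> count_mem D w <= count_mem U w.
Proof. by move/dyck_prefixP/(_ (size w)); rewrite take_size. Qed.

(** The mirror image of the lattice path drawn by [w]. *)
Definition flip (w : seq letter) : seq letter := map negb (rev w).

Lemma flipK : involutive flip.
Proof.
by move=> w; rewrite /flip -map_rev revK mapK //; exact: negbK.
Qed.

Lemma size_flip (w : seq letter) : size (flip w) = size w.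
Proof. by rewrite size_map size_rev. Qed.

Lemma count_flip (x : letter) (w : seq letter) :
  count_mem x (flip w) = count_mem (~~ x) w.
Proof.
rewrite count_map count_rev; apply: eq_count => y /=.
by case: x; case: y.
Qed.

(** A prefix of [flip w] is the flip of a suffix of [w], and flipping exchanges the two letter
    counts. *)
Lemma dyck_prefix_flipP (w : seq letter) :
  reflect (forall m, count_mem U (drop m w) <= count_mem D (drop m w))
          (dyck_prefix (flip w)).
Proof.
have takeE m : take m (flip w) = flip (drop (size w - m) w).
  by rewrite /flip -map_take take_rev.
apply: (iffP (dyck_prefixP _)) => H m.
  have [le_mw|lt_wm] := leqP m (size w); last by rewrite drop_oversize // ltnW.
  by have := H (size w - m); rewrite takeE !count_flip subKn.
by rewrite takeE !count_flip; apply: H.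
Qed.

(** Since the whole word is balanced, a prefix reaching into [b] has no excess of D's exactly when
    the suffix of [b] left over has no excess of U's. *)
Lemma dyck_prefix_cat (a b : seq letter) :
  count_mem U (a ++ b) = count_mem D (a ++ b) ->
  dyck_prefix (a ++ b) = dyck_prefix a && dyck_prefix (flip b).
Proof.
rewrite !count_cat => eqUD.
have cnt (x : letter) m :
    count_mem x b = count_mem x (take m b) + count_mem x (drop m b).
  by rewrite -count_cat cat_take_drop.
apply/dyck_prefixP/andP => [H|[/dyck_prefixP Ha /dyck_prefix_flipP Hb] m].
  split; [apply/dyck_prefixP => m|apply/dyck_prefix_flipP => m].
    have [le_am|lt_ma] := leqP (size a) m; last first.
      by have := H m; rewrite take_cat lt_ma.
    have := H (size a); rewrite take_cat ltnn subnn take0 cats0.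
    by rewrite take_oversize.
  have := H (size a + m); rewrite take_cat ltnNge leq_addr /= addKn !count_cat.
  by move: eqUD; rewrite (cnt U m) (cnt D m) /=; lia.
rewrite take_cat; case: ifP => // _; rewrite !count_cat.
have := Hb (m - size a).
by move: eqUD; rewrite (cnt U (m - size a)) (cnt D (m - size a)); lia.
Qed.

Lemma subseq_nseq (T : eqType) (k : nat) (x : T) (s : seq T) :
  subseq (nseq k x) s = (k <= count_mem x s).
Proof.
apply/idP/idP => [/(leq_count_subseq (pred1 x))|le_k].
  by rewrite count_nseq /= eqxx mul1n.
apply: subseq_trans (filter_subseq (pred1 x) s).
have /all_pred1P -> := filter_all (pred1 x) s.
by rewrite size_filter -(subnKC le_k) nseqD prefix_subseq.
Qed.

(** Induction along the greedy matching: letters of [w] go to the left part until [s1] is used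
    up. *)
Lemma subseq_cat_split (T : eqType) (s1 s2 w : seq T) :
  subseq (s1 ++ s2) w ->
  exists m, subseq s1 (take m w) && subseq s2 (drop m w).
Proof.
elim: w s1 => [|y w IH] [|x s1] //=.
- by exists 0.
- by exists 0.
case: eqP => [->|/eqP neq_xy] H.
  by have [m Hm] := IH _ H; exists m.+1 => /=; rewrite eqxx.
have [m Hm] := IH (x :: s1) H.
by exists m.+1 => /=; rewrite (negPf neq_xy).
Qed.

Lemma contains_UD_cat (k : nat) (a b : seq letter) :
  count_mem D b = count_mem U a ->
  contains (nseq k U ++ nseq k D) (a ++ b) = (k <= count_mem U a).
Proof.
move=> eq_ba; rewrite /contains; apply/idP/idP => [|le_k]; last first.
  by rewrite cat_subseq // subseq_nseq ?eq_ba.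
case/subseq_cat_split => m; rewrite !subseq_nseq => /andP[HU HD].
(* If the cut [m] falls inside [a], all k U's come from [a]; otherwise all k D's come from [b]. *)
move: HU HD; rewrite take_cat drop_cat; case: ifP => _ HU HD.
  by apply: leq_trans HU _; apply/leq_count_subseq/take_subseq.
by apply: leq_trans HD _; rewrite -eq_ba; apply/leq_count_subseq/drop_subseq.
Qed.

Definition prefixes (n i : nat) : {set n.-tuple letter} :=
  [set w : n.-tuple letter | dyck_prefix w && (count_mem U w == i)].

Lemma flip_tupleP (n : nat) (w : n.-tuple letter) : size (flip w) == n.
Proof. by rewrite size_flip size_tuple. Qed.

(** The second half is stored flipped, so that both components of a Dyck path become Dyck prefixes
    of the same kind. *)
Definition glue (n : nat) (p : n.-tuple letter * n.-tuple letter) :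
  (n + n).-tuple letter := cat_tuple p.1 (Tuple (flip_tupleP n p.2)).

Lemma glue_inj (n : nat) : injective (glue n).
Proof.
move=> [a b] [c d] /(congr1 val)/eqP /=.
rewrite eqseq_cat ?size_tuple // => /andP[/eqP eq_ac /eqP eq_bd].
by congr (_, _); apply: val_inj => //=; apply: (inv_inj flipK).
Qed.

Lemma glue_surj (n : nat) (w : (n + n).-tuple letter) :
  exists p, w = glue n p.
Proof.
have sza : size (take n w) == n by rewrite size_takel // size_tuple leq_addr.
have szb : size (flip (drop n w)) == n.
  by rewrite size_flip size_drop size_tuple addKn.
exists (Tuple sza, Tuple szb); apply: val_inj.
by rewrite /= flipK cat_take_drop.
Qed.

Lemma dyck_path_glue (n : nat) (p : n.-tuple letter * n.-tuple letter) :
  dyck_path n (glue n p) =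
  [&& dyck_prefix p.1, dyck_prefix p.2 & count_mem U p.1 == count_mem U p.2].
Proof.
case: p => a b /=.
have := count_UD a; have := count_UD b; rewrite !size_tuple => szb sza.
rewrite /dyck_path /= andbA.
(* The glued word has [count_mem U a + (n - count_mem U b)] letters U. *)
have -> : (count_mem U (a ++ flip b) == n) && (count_mem D (a ++ flip b) == n)
          = (count_mem U a == count_mem U b).
  rewrite !count_cat !count_flip; move: sza szb; rewrite /U /D /= => sza szb.
  by apply/andP/eqP => [[/eqP ? /eqP ?]|?]; [|split; apply/eqP]; lia.
case: eqP => [eq_ab|_]; last by rewrite !andbF.
rewrite andbT dyck_prefix_cat ?flipK //.
by rewrite !count_cat !count_flip /=; move: eq_ab sza szb; rewrite /U /D /=; lia.
Qed.

Lemma num_avoiding_UD (n k : nat) :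
  num_avoiding n (nseq k U ++ nseq k D) = \sum_(i < k) #|prefixes n i| ^ 2.
Proof.
rewrite /num_avoiding mul2n -addnn.
set A := [set w | _].
have -> : A = glue n @: [set p : n.-tuple letter * n.-tuple letter |
    [&& dyck_prefix p.1, dyck_prefix p.2, count_mem U p.1 == count_mem U p.2
      & count_mem U p.1 < k]].
  apply/setP => w; have [p ->] := glue_surj n w.
  rewrite (mem_imset _ _ (@glue_inj n)) !inE dyck_path_glue.
  case: (boolP (dyck_prefix p.1)) => //= _.
  case: (boolP (dyck_prefix p.2)) => //= _.
  case: eqP => //= eq_p; rewrite contains_UD_cat -?ltnNge //.
  by rewrite /= count_flip eq_p.
rewrite card_imset; last exact: glue_inj.
set B := [set p | _].
rewrite -sum1_card.
(* The classes below are indexed through [inord], which requires a nonempty ordinal type; for k = 0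
   the set is empty. *)
case: k @A @B => [|k] A B.
  by rewrite big_ord0 big1 // => p; rewrite inE ltn0 !andbF.
(* Pairs are sorted by their common number [i] of U's; each class is the full product of
   [prefixes n i] with itself, whence the square. *)
rewrite (partition_big
  (fun p : _ * _ => inord (count_mem U (tval p.1)) : 'I_k.+1) xpredT) //=.
apply: eq_bigr => i _; rewrite -mulnn -cardsX -sum1_card.
apply: eq_bigl => -[a b]; rewrite !inE /= -val_eqE /=.
case: (boolP (dyck_prefix a)) => //= _.
case: (boolP (dyck_prefix b)) => //= _; rewrite ?andbF //.
(* [inord] gives a default value on counts above [k], but such pairs lie on neither side. *)
have [lt_ak|le_ka] := ltnP (count_mem U a) k.+1.
  rewrite andbT inordK // andbC.
  by case: eqP => //= ->; rewrite eq_sym.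
rewrite andbF; apply/esym/andP => -[/eqP eq_ai _].
by have := ltn_ord i; rewrite -eq_ai ltnNge le_ka.
Qed.

Lemma prefixes_eq0 (n i : nat) : i.*2 < n -> #|prefixes n i| = 0.
Proof.
move=> lt_in; apply: eq_card0 => w; rewrite inE.
apply/andP => -[/dyck_prefix_count + /eqP].
by have := count_UD w; rewrite size_tuple /letter /=; lia.
Qed.

Lemma prefixes_gt (n i : nat) : n < i -> #|prefixes n i| = 0.
Proof.
move=> lt_ni; apply: eq_card0 => w; rewrite inE.
apply/andP => -[_ /eqP].
by have := count_size (pred1 U) w; rewrite size_tuple /letter /=; lia.
Qed.

(** For natural arguments the guard fails only if i < j, and then there is no such Dyck prefix. *)
Lemma ballot_prefixes (i j : nat) : ballot i j = #|prefixes (i + j) i|.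
Proof.
rewrite /ballot; case: ifP => [_|/negbT lt_ij]; last first.
  by rewrite prefixes_eq0 //; lia.
apply: eq_card => w; rewrite !inE; have := count_UD w.
rewrite size_tuple /letter /= => szw.
case: eqP => [eq_i|]; last by rewrite andbF.
by move: szw; rewrite eq_i => /addnI ->; rewrite eqxx andbT.
Qed.

(** The indices add up to n. If k - j > n, the second one is negative and both sides vanish. *)
Lemma ballot_diag (n k j : nat) : j <= k ->
  ballot (k%:Z - j%:Z)%R (n%:Z - k%:Z + j%:Z)%R = #|prefixes n (k - j)|.
Proof.
move=> le_jk; have [le_kn|lt_nk] := leqP (k - j) n.
  have -> : (k%:Z - j%:Z)%R = (k - j)%N by lia.
  have -> : (n%:Z - k%:Z + j%:Z)%R = (n - (k - j))%N by lia.
  by rewrite ballot_prefixes subnKC.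
by rewrite prefixes_gt // /ballot ifF //; lia.
Qed.

(* The right-hand sum is the finitely supported sum over all j >= 1; its
   support is finite because the j-th term vanishes as soon as j > k. *)
Theorem mainTheorem5 (k n : nat) (hk : 1 <= k) :
  num_avoiding n (nseq k U ++ nseq k D) =
  if 2 * k - 1 <= n then 0
  else (\sum_(j \in [set j : nat | (1 <= j)%N]%classic)
          (ballot (k%:Z - j%:Z) (n%:Z - k%:Z + j%:Z) ^ 2)%N)%R.
Proof.
rewrite num_avoiding_UD; case: ifP => [le_kn|_].
  (* Here i <= k - 1 gives 2i <= 2k - 2 < n. *)
  by apply: big1 => i _; rewrite prefixes_eq0 //; have := ltn_ord i; lia.
rewrite (@fsbigE _ _ _ _ _ (iota 1 k)) ?iota_uniq //=; first last.
- move=> j /= j_gt0; rewrite mem_iota => j_gtk.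
  by rewrite /ballot ifF //; lia.
- by move=> j /=; rewrite mem_iota => /andP[].
(* The substitution i = k - j turns 0 <= i < k into 1 <= j <= k. *)
transitivity (\sum_(1 <= j < k.+1) #|prefixes n (k - j)| ^ 2).
  rewrite -(big_mkord xpredT (fun i => #|prefixes n i| ^ 2)) big_nat_rev /=.
  by rewrite big_add1.
rewrite /index_iota subn1 [RHS]big_seq_cond [LHS]big_seq /=.
apply: eq_big => [j|j]; rewrite mem_iota; last case/andP=> _ le_jk.
  by case: (ltnP 0 j) => // j_gt0; rewrite mem_set ?andbT.
by rewrite ballot_diag //; lia.
Qed.
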